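(* For any positive integers $m,n$ such that $\frac{4}{5}\le \frac{m}{n}<1$, there is a finite connected graph $G$ with $\mu(G)=m$ and $\nu(G)=n$.
   Context: All graphs are finite, simple, undirected and loopless. For a graph $G$, $\nu(G)$ is the maximum size of a matching in $G$. $\lambda(G)=\max\{|H|+|H'| : H,H' \text{ are disjoint matchings in } G\}$, $\Lambda(G)$ is the set of ordered pairs $(H,H')$ of disjoint matchings of $G$ with $|H|+|H'|=\lambda(G)$, and $\mu(G)=\max\{|H| : \text{there is } H' \text{ with } (H,H')\in\Lambda(G)\}$. *)

(* Defs.v *)
From mathcomp Require Import all_boot.

Set Implicit Arguments.
Unset Strict Implicit.
Unset Printing Implicit Defensive.

Record sgraph := SGraph {
  vertex :> finType;
  adj : rel vertex;
  adj_sym : symmetric adj;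
  adj_irrefl : irreflexive adj
}.

Section Graph.

Variable G : sgraph.

(* Edges are encoded as the two-element sets of adjacent vertices. *)
Definition edges : {set {set G}} :=
  [set [set p.1; p.2] | p : G * G & adj p.1 p.2].

Definition connected : Prop :=
  0 < #|G| /\ forall x y : G, connect (@adj G) x y.

Definition is_matching (H : {set {set G}}) : bool :=
  (H \subset edges) && trivIset H.

Definition disjoint_matchings (P : {set {set G}} * {set {set G}}) : bool :=
  [&& is_matching P.1, is_matching P.2 & [disjoint P.1 & P.2]].

Definition nu : nat := \max_(H : {set {set G}} | is_matching H) #|H|.

Definition lambda : nat :=
  \max_(P : {set {set G}} * {set {set G}} | disjoint_matchings P)
     (#|P.1| + #|P.2|).

Definition Lambda : {set {set {set G}} * {set {set G}}} :=
  [set P | disjoint_matchings P && (#|P.1| + #|P.2| == lambda)].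

Definition mu : nat := \max_(P in Lambda) #|P.1|.

End Graph.

(* Main.v *)
(** Put [k = n - m], so that [m >= 4k].  Take a complete graph on [2k] core
    vertices and attach to them [m] pendant paths of length two (legs), at least
    two to each core vertex.  This graph has a perfect matching of size [m + k]:
    the outer edges of all the legs and a perfect matching of the core.
    In a pair of disjoint matchings, an edge that is not outer uses up one of the
    two slots of a core vertex, and a core edge uses up two of them; hence the
    pair has at most [m + 2 * 2k] edges, and this bound is attained only without
    core edges.  A matching without core edges has at most one edge per leg. *)
Require Import Defs.
From mathcomp Require Import all_boot all_order all_algebra.
From mathcomp Require Import zify.
Import Order.TTheory GRing.Theory Num.Theory.

Set Implicit Arguments.
Unset Strict Implicit.
Unset Printing Implicit Defensive.

(** * Counting points of pairwise disjoint sets and of pairs *)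

Lemma sum_card_setI_trivIset (T : finType) (P : {set {set T}}) (C : {set T}) :
  trivIset P -> \sum_(B in P) #|B :&: C| <= #|C|.
Proof.
(* Disjointness turns the sum over members into a sum over points of their union, so each point of
   [C] counts at most once. *)
move=> tP; have -> : \sum_(B in P) #|B :&: C| = \sum_(x in cover P) (x \in C).
  rewrite big_trivIset //=; apply: eq_bigr => B _.
  by rewrite -sum1dep_card big_mkcondr; apply: eq_bigr => x _; case: (x \in C).
rewrite -big_mkcondr sum1dep_card; apply: subset_leq_card.
by apply/subsetP => x; rewrite inE => /andP[].
Qed.

(** The hypotheses exclude the swapped identification, so equal edges can be compared end by end. *)
Lemma eq_set2 (T : finType) (x y x' y' : T) :
  x != y' -> y != x' -> [set x; y] = [set x'; y'] -> x = x' /\ y = y'.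
Proof.
move=> xy' yx' E; split.
  by move: (set21 x y); rewrite E !inE (negPf xy') orbF => /eqP.
by move: (set22 x y); rewrite E !inE (negPf yx') => /eqP.
Qed.

Lemma card_set2I (T : finType) (x y : T) (C : {set T}) :
  x != y -> #|[set x; y] :&: C| = (x \in C) + (y \in C).
Proof.
move=> xy; rewrite setIUl cardsU.
have cI z : #|[set z] :&: C| = (z \in C).
  case: (boolP (z \in C)) => zC; first by rewrite (setIidPl _) ?cards1 ?sub1set.
  by apply/eqP; rewrite cards_eq0 setI_eq0 disjoints1.
have -> : [set x] :&: C :&: ([set y] :&: C) = set0.
  apply/setP => z; rewrite !inE; case: eqP => // ->.
  by rewrite (negPf xy) andbF.
by rewrite !cI cards0 subn0.
Qed.

(** * Matchings given by two injective families of ends *)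

Section MatchingOfFamily.

Variables (G : sgraph) (I : finType) (x y : I -> G).
Hypotheses (x_inj : injective x) (y_inj : injective y).
Hypotheses (xNy : forall i j, x i != y j) (xy_adj : forall i, adj (x i) (y i)).

Definition family_edges : {set {set G}} := [set [set x i; y i] | i : I].

Lemma card_family_edges : #|family_edges| = #|I|.
Proof.
apply: card_imset => i j E.
by have [] := @eq_set2 _ (x i) (y i) (x j) (y j) (xNy i j) _ E;
  [rewrite eq_sym | move/x_inj].
Qed.

Lemma matching_family_edges : is_matching family_edges.
Proof.
apply/andP; split.
  apply/subsetP => _ /imsetP[i _ ->]; apply/imsetP.
  by exists (x i, y i); rewrite ?inE //=; exact: xy_adj.
apply/trivIsetP => _ _ /imsetP[i _ ->] /imsetP[j _ ->] neq.
have ij : i != j by apply: contraNneq neq => ->.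
rewrite -setI_eq0; apply/eqP/setP => z; rewrite !inE.
apply/negP => /andP[/orP[] /eqP-> /orP[] /eqP].
- by move/x_inj/eqP; rewrite (negPf ij).
- by move/eqP; rewrite (negPf (xNy _ _)).
- by move/esym/eqP; rewrite (negPf (xNy _ _)).
- by move/y_inj/eqP; rewrite (negPf ij).
Qed.

End MatchingOfFamily.

(** * Complete graphs with pendant legs of length two *)

Section LeggedClique.

Variables (K L : finType) (foot : L -> K).

Definition lc_vertex : finType := (K + (L + L))%type.
Definition core (v : K) : lc_vertex := inl v.
Definition inner (l : L) : lc_vertex := inr (inl l).
Definition outer (l : L) : lc_vertex := inr (inr l).

Definition lc_adj : rel lc_vertex := fun x y =>
  match x, y with
  | inl v, inl w => v != w
  | inl v, inr (inl l) | inr (inl l), inl v => foot l == v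
  | inr (inl l), inr (inr l') | inr (inr l), inr (inl l') => l == l'
  | _, _ => false
  end.

Lemma lc_adj_sym : symmetric lc_adj.
Proof. by move=> [v|[l|l]] [w|[l'|l']] //=; rewrite eq_sym. Qed.

Lemma lc_adj_irrefl : irreflexive lc_adj.
Proof. by move=> [v|[l|l]] //=; rewrite eqxx. Qed.

Definition lc_graph := SGraph lc_adj_sym lc_adj_irrefl.

Lemma lc_connected (v0 : K) : connected lc_graph.
Proof.
have csym : connect_sym (@adj lc_graph) := sym_connect_sym lc_adj_sym.
split; first by apply/card_gt0P; exists (core v0).
suff to0 (x : lc_graph) : connect (@adj lc_graph) x (core v0).
  by move=> x y; apply: connect_trans (to0 x) _; rewrite csym.
have to0_core v : connect (@adj lc_graph) (core v) (core v0).
  by have [->|nv] := eqVneq v v0; [exact: connect0 | exact: connect1].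
have to0_inner l : connect (@adj lc_graph) (inner l) (core v0).
  by apply: connect_trans (to0_core (foot l)); apply: connect1; exact: eqxx.
case: x => [v|[l|l]]; [exact: to0_core | exact: to0_inner |].
by apply: connect_trans (to0_inner l); apply: connect1; exact: eqxx.
Qed.

(** * Upper bounds by counting core and inner vertices *)

Definition cores : {set lc_graph} := [set core v | v : K].
Definition inners : {set lc_graph} := [set inner l | l : L].
Definition outer_edges : {set {set lc_graph}} :=
  [set [set inner l; outer l] | l : L].

Lemma card_cores : #|cores| = #|K|.
Proof. by rewrite card_imset // => v w []. Qed.

Lemma card_inners : #|inners| = #|L|.
Proof. by rewrite card_imset // => l l' []. Qed.

Lemma mem_cores (x : lc_graph) : x \in cores = if x is inl _ then true else false.
Proof. by apply/imsetP/idP => [[v _ ->] //|]; case: x => // v _; exists v. Qed.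

Lemma mem_inners (x : lc_graph) :
  x \in inners = if x is inr (inl _) then true else false.
Proof.
by apply/imsetP/idP => [[l _ ->] //|]; case: x => // [[l|//]] _; exists l.
Qed.

(** Local inequalities, to be summed over a matching. A core edge meets [cores] twice, an edge from
    core to leg meets it once, and the rest are outer edges; every edge that is not a core edge has
    an inner end. *)
Lemma lc_edge_counts (e : {set lc_graph}) : e \in edges lc_graph ->
  #|e| = 2 /\
  (1 + (#|e :&: cores| == 2) <= #|e :&: cores| + (e \in outer_edges) /\
   1 <= #|e :&: inners| + (#|e :&: cores| == 2)).
Proof.
case/imsetP => -[x y]; rewrite inE /= => xy ->.
have nxy : x != y by apply: contraTneq xy => ->; rewrite lc_adj_irrefl.
split; first by rewrite cards2 nxy.
rewrite !card_set2I // !mem_cores !mem_inners.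
case: x y xy nxy => [v|[l|l]] [w|[l'|l']] //= /eqP E _; rewrite ?addn0 //.
- have -> : [set inr (inl l); inr (inr l')] \in outer_edges; last by [].
  by apply/imsetP; exists l; rewrite // E.
- have -> : [set inr (inr l); inr (inl l')] \in outer_edges; last by [].
  by apply/imsetP; exists l; rewrite // E setUC.
Qed.

Definition core_edges (H : {set {set lc_graph}}) : nat :=
  \sum_(e in H) (#|e :&: cores| == 2).

(** The edges of a matching share [#|K|] core slots: a core edge takes two, an outer edge none, any
    other edge one. *)
Lemma matching_card_le_core (H : {set {set lc_graph}}) : is_matching H ->
  #|H| + core_edges H <= #|K| + #|H :&: outer_edges|.
Proof.
case/andP => /subsetP He tH.
rewrite -card_cores.
apply: leq_trans _ (leq_add (sum_card_setI_trivIset _ tH) (leqnn _)).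
rewrite -sum1_card -big_split /= -[X in _ + X]sum1dep_card big_mkcondr -big_split /=.
apply: leq_sum => e /He /lc_edge_counts [_ [+ _]].
by case: (e \in outer_edges).
Qed.

Lemma matching_card_le_inner (H : {set {set lc_graph}}) : is_matching H ->
  #|H| <= #|L| + core_edges H.
Proof.
case/andP => /subsetP He tH.
rewrite -card_inners.
apply: leq_trans _ (leq_add (sum_card_setI_trivIset _ tH) (leqnn _)).
rewrite -sum1_card -big_split /=.
by apply: leq_sum => e /He /lc_edge_counts [_ []].
Qed.

Lemma matching_card_le_half (H : {set {set lc_graph}}) : is_matching H ->
  #|H|.*2 <= #|K| + #|L|.*2.
Proof.
case/andP => /subsetP He tH.
have := sum_card_setI_trivIset setT tH.
rewrite cardsT !card_sum addnn (eq_bigr (fun=> 2)) => [|e /He /lc_edge_counts[]].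
  by rewrite sum_nat_const muln2.
by rewrite setIT.
Qed.

(** The core bound is applied to both matchings; being disjoint, they share the [#|L|] outer edges.
    The term [core_edges P.1] stays on the left so that attaining the bound forces [P.1] to avoid
    core edges. *)
Lemma disjoint_matchings_card_le (P : {set {set lc_graph}} * {set {set lc_graph}}) :
  disjoint_matchings P -> #|P.1| + #|P.2| + core_edges P.1 <= #|L| + #|K|.*2.
Proof.
case/and3P => m1 m2 d12.
have := matching_card_le_core m1; have := matching_card_le_core m2.
have : #|P.1 :&: outer_edges| + #|P.2 :&: outer_edges| <= #|L|.
  apply: leq_trans (leq_imset_card (fun l => [set inner l; outer l]) L).
  set A := _ :&: _; set B := _ :&: _.
  have /eqP <- : #|A :|: B| == #|A| + #|B|.
    rewrite (leq_card_setU A B).2.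
    by apply: disjointWl (subsetIl _ _) _; apply: disjointWr (subsetIl _ _) _.
  by rewrite -setIUl; exact/subset_leq_card/subsetIr.
lia.
Qed.

(** * An extremal pair from two chosen legs at each core vertex *)

Section TwoLegs.

Variables s t : K -> L.
Hypotheses (foot_s : cancel s foot) (foot_t : cancel t foot).
Hypothesis sNt : forall v, s v != t v.

Let sNt' v w : s v != t w.
Proof.
by apply: contra_neq (sNt v) => E; rewrite {2}(_ : v = w) // -(foot_s v) E foot_t.
Qed.

(** The big matching uses one edge of every leg: the one at the core for the legs [s v], the outer
    one elsewhere. *)
Definition big_end (l : L) : lc_graph :=
  if l == s (foot l) then core (foot l) else outer l.
Definition big_matching := family_edges (inner : L -> lc_graph) big_end.

(** The small matching makes the opposite choice on the legs [s v] and [t v], and uses no other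
    leg. *)
Definition small_start (p : K * bool) : lc_graph :=
  inner (if p.2 then t p.1 else s p.1).
Definition small_end (p : K * bool) : lc_graph :=
  if p.2 then core p.1 else outer (s p.1).
Definition small_matching := family_edges small_start small_end.

Lemma big_matchingP : is_matching big_matching /\ #|big_matching| = #|L|.
Proof.
have i_inj : injective (inner : L -> lc_graph) by move=> l l' [].
have e_inj : injective big_end.
  move=> l l'; rewrite /big_end.
  by case: eqP => [El|_]; case: eqP => [El'|_] // [] // E; rewrite El El' E.
have iNe i j : inner i != big_end j by rewrite /big_end; case: ifP.
split; last exact: card_family_edges.
by apply: matching_family_edges => // l; rewrite /big_end; case: ifP => /=.
Qed.

Lemma small_matchingP : is_matching small_matching /\ #|small_matching| = #|K|.*2.
Proof.
have s_inj := can_inj foot_s; have t_inj := can_inj foot_t.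
have st_inj : injective small_start.
  move=> [v [|]] [w [|]] [] //.
  - by move/t_inj->.
  - by move/esym/eqP; rewrite (negPf (sNt' _ _)).
  - by move/eqP; rewrite (negPf (sNt' _ _)).
  - by move/s_inj->.
have e_inj : injective small_end.
  by move=> [v [|]] [w [|]] [] // => [->|/s_inj->].
have sNe i j : small_start i != small_end j.
  by case: j => v [].
split; last by rewrite card_family_edges // card_prod card_bool muln2.
apply: matching_family_edges => // -[v [|]] /=; last exact: eqxx.
by rewrite foot_t.
Qed.

Lemma big_small_disjoint : [disjoint big_matching & small_matching].
Proof.
rewrite -setI_eq0; apply/eqP/setP => e; rewrite !inE.
apply/negP => /andP[/imsetP[l _ ->] /imsetP[[v b] _]].
case/eq_set2; rewrite /big_end /small_end /small_start.
- by case: b.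
- by case: ifP.
(* Equal inner ends place both edges on the same leg, [t v] or [s v], where the two matchings use
   different edges. *)
move=> [->]; case: b => /=.
  by rewrite foot_t eq_sym (negPf (sNt v)).
by rewrite foot_s eqxx.
Qed.

Lemma lc_disjoint_matchings : disjoint_matchings (big_matching, small_matching).
Proof.
by apply/and3P; split; [case: big_matchingP | case: small_matchingP
  | exact: big_small_disjoint].
Qed.

Lemma lc_lambda : lambda lc_graph = #|L| + #|K|.*2.
Proof.
apply/eqP; rewrite eqn_leq; apply/andP; split.
  apply/bigmax_leqP => P /disjoint_matchings_card_le.
  exact/leq_trans/leq_addr.
apply: leq_trans (leq_bigmax_cond _ lc_disjoint_matchings) => /=.
by rewrite big_matchingP.2 small_matchingP.2.
Qed.

Lemma lc_mu : mu lc_graph = #|L|.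
Proof.
apply/eqP; rewrite eqn_leq; apply/andP; split.
  apply/bigmax_leqP => P; rewrite inE lc_lambda => /andP[dP /eqP cP].
  (* The pair attains the bound, so [P.1] has no core edge and each of its edges has its own inner
     vertex. *)
  have := disjoint_matchings_card_le dP; rewrite cP.
  rewrite -[X in _ <= X]addn0 leq_add2l leqn0 => /eqP no_core.
  by case/and3P: dP => /matching_card_le_inner; rewrite no_core addn0.
rewrite -big_matchingP.2.
have BS_Lambda : (big_matching, small_matching) \in Lambda lc_graph.
  by rewrite inE lc_disjoint_matchings lc_lambda /= big_matchingP.2 small_matchingP.2.
exact: (leq_bigmax_cond (big_matching, small_matching) BS_Lambda).
Qed.

End TwoLegs.

End LeggedClique.

(** * The matching number *)

Lemma lc_nu (I L : finType) (foot : L -> I * bool) :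
  nu (lc_graph foot) = #|L| + #|I|.
Proof.
apply/eqP; rewrite eqn_leq; apply/andP; split.
  apply/bigmax_leqP => H /matching_card_le_half.
  by rewrite card_prod card_bool; lia.
(* A perfect matching: all outer edges, and the core paired by [(i, true)] with [(i, false)]. *)
pose x (j : L + I) : lc_graph foot :=
  match j with inl l => inner _ l | inr i => core L (i, true) end.
pose y (j : L + I) : lc_graph foot :=
  match j with inl l => outer _ l | inr i => core L (i, false) end.
have x_inj : injective x by move=> [l|i] [l'|i'] // [->].
have y_inj : injective y by move=> [l|i] [l'|i'] // [->].
have xNy i j : x i != y j by apply/eqP; case: i j => [l|i] [l'|i'].
have xy_adj i : adj (x i) (y i).
  by case: i => [l|i]; [exact: eqxx | rewrite /= xpair_eqE andbF].
rewrite -card_sum -(card_family_edges x_inj xNy).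
exact: (leq_bigmax_cond _ (matching_family_edges x_inj y_inj xNy xy_adj)).
Qed.

(** * Choice of the parameters *)

Local Open Scope ring_scope.

Theorem theorem1p1 (m n : nat) (m_gt0 : (0 < m)%N) (n_gt0 : (0 < n)%N)
    (hmn : 4%:R / 5%:R <= (m%:R / n%:R : rat) < 1) :
  exists G : sgraph, [/\ connected G, mu G = m & nu G = n].
Proof.
have n0 : 0 < n%:R :> rat by rewrite ltr0n.
case/andP: hmn; rewrite ler_pdivlMr // mulrAC ler_pdivrMr ?ltr0n //.
rewrite ltr_pdivrMr // mul1r -!natrM ler_nat ltr_nat => le45 lt_mn.
(* Here [k.+1] is [n - m], positive since [m < n], and [r] is the excess of [m] over [4 * (n - m)],
   available since [4 * n <= 5 * m]. *)
have [k [r [-> ->]]] : exists k r, m = (4 * k.+1 + r)%N /\ n = (5 * k.+1 + r)%N.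
  by exists (n - m).-1, (m - 4 * (n - m))%N; lia.
(* Two legs at each of the [2 * k.+1] core vertices, and the [r] remaining ones all at [v0]. *)
pose I := 'I_k.+1; pose L := (I * bool * bool + 'I_r)%type.
pose v0 : I * bool := (ord0, true).
pose foot (l : L) := if l is inl p then p.1 else v0.
pose s v : L := inl (v, true); pose t v : L := inl (v, false).
have cL : #|{: L}| = (4 * k.+1 + r)%N.
  by rewrite card_sum !card_prod !card_bool !card_ord; lia.
exists (lc_graph foot); split; first exact: lc_connected v0.
  have sNt v : s v != t v by apply/eqP => -[].
  by rewrite (lc_mu (foot := foot) (s := s) (t := t)).
by rewrite lc_nu cL card_ord; lia.
Qed.
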